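(* Let $R$ be the Rado graph on $\mathbb{N}=\{0,1,2,\ldots\}$, let $Q(j)=2^{-(j+1)}$ for $j\in\mathbb{N}$, and let $K$ and $\pi$ be the transition matrix of the ball walk on $R$ generated by $Q$ and its stationary distribution, that is, $K(i,j)=Q(j)/Q(N(i))$ if $i\sim j$ and $K(i,j)=0$ otherwise, and $\pi(i)=Q(i)Q(N(i))/Z$. Then: (1) there are universal constants $A,B>0$ such that $$\|K_i^\ell-\pi\|\le A\,e^{\log_2^* i}\,e^{-B\ell}\qquad\text{for all } i\in\mathbb{N},\ \ell\ge 1;$$ (2) there is a universal constant $C>0$ such that, for every integer $k\ge 1$, with $2^{(k)}=2^{2^{\cdot^{\cdot^{\cdot^{2}}}}}$ denoting the tower of $2$'s of height $k$, $$\|K^\ell_{2^{(k)}}-\pi\|\ge C\qquad\text{for all nonnegative integers } \ell\le k.$$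
   Context: The Rado graph $R$ has vertex set $\mathbb{N}=\{0,1,2,\ldots\}$, with an undirected edge between $i$ and $j$ (written $i\sim j$) when $i<j$ and the $i$-th binary digit of $j$ is $1$, where the $0$-th digit is the first digit from the right. $N(i)=\{j: j\sim i\}$ is the neighbor set of $i$, and $Q(S)=\sum_{j\in S}Q(j)$ for $S\subset\mathbb{N}$. $Z=\sum_{i}Q(i)Q(N(i))$ is the normalizing constant. $K^\ell$ is the $\ell$-th matrix power of $K$, $K_i^\ell$ is the probability $K^\ell(i,\cdot)$, and $\|K_i^\ell-\pi\|=\frac12\sum_{j=0}^\infty|K^\ell(i,j)-\pi(j)|$ is total variation distance. The tower is given by $2^{(1)}=2$ and $2^{(k+1)}=2^{2^{(k)}}$. $\log_2^* i$ is the number of times $\log_2$ needs to be applied, starting from $i$, to get a result $\le 1$ (it is $0$ if $i\le 1$). *)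

(* Defs.v *)
From mathcomp Require Import all_boot all_order all_algebra.
From mathcomp Require Import all_classical all_reals all_analysis.

Set Implicit Arguments.
Unset Strict Implicit.
Unset Printing Implicit Defensive.

Import Order.TTheory GRing.Theory Num.Theory.

Local Open Scope ring_scope.

(* [odd (n %/ 2 ^ i)] is binary digit number [i] of [n], counted from 0 at the
   least significant end. *)
Definition rado_adj : rel nat := fun i j =>
  ((i < j) && odd (j %/ 2 ^ i) || (j < i) && odd (i %/ 2 ^ j))%N.

Definition rado_nbr (i : nat) : pred nat := fun j => rado_adj j i.

Section BallWalk.
Context {R : realType}.
Implicit Types (Q : nat -> R) (K : nat -> nat -> R).

(* The series below have nonnegative terms when [Q] is nonnegative and [K] is
   a stochastic matrix.  They are taken in [\bar R] and brought back to [R] by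
   [fine]; no value is lost when their sums are finite, as they are whenever
   [Q] is summable and [K] is stochastic. *)
Definition Qset Q (S : pred nat) : R :=
  fine (\sum_(0 <= j <oo | S j) (Q j)%:E)%E.

Definition ballZ Q : R :=
  fine (\sum_(0 <= i <oo) (Q i * Qset Q (rado_nbr i))%:E)%E.

Definition ballK Q (i j : nat) : R :=
  if rado_adj i j then Q j / Qset Q (rado_nbr i) else 0.

Definition ballpi Q (i : nat) : R := Q i * Qset Q (rado_nbr i) / ballZ Q.

Fixpoint kpow K (l : nat) (i j : nat) : R :=
  if l is l'.+1 then fine (\sum_(0 <= k <oo) (K i k * kpow K l' k j)%:E)%E
  else (i == j)%:R.

Definition tv_dist (p q : nat -> R) : \bar R :=
  ((2^-1)%:E * \sum_(0 <= j <oo) `|p j - q j|%:E)%E.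

Definition Qgeom (j : nat) : R := 2^-1 ^+ j.+1.

Definition log2 (x : R) : R := ln x / ln 2.

Lemma log2_le_nat (n : nat) (x : R) : x <= n.+2%:R -> log2 x <= n.+1%:R.
Proof.
move=> xn; have ln2_gt0 : 0 < ln (2 : R) by rewrite ln_gt0 // ltr1n.
rewrite /log2 ler_pdivrMr //.
have [x0|x0] := leP x 0; first by rewrite ln0 // mulr_ge0 // ltW.
rewrite mulr_natl -lnXn // ler_ln ?posrE ?exprn_gt0 //.
by rewrite (le_trans xn) // -natrX ler_nat ltn_expl.
Qed.

Lemma ex_iter_log2_le1 (x : R) : exists k, iter k log2 x <= 1.
Proof.
suff H n : forall y : R, y <= n.+1%:R -> exists k, iter k log2 y <= 1.
  apply: (H (Num.bound `|x|)); apply: le_trans (ler_norm x) _.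
  apply/ltW/(lt_le_trans (archi_boundP (normr_ge0 x))).
  by rewrite ler_nat.
elim: n => [|n IHn] y yn; first by exists 0.
have [k Hk] := IHn _ (log2_le_nat yn).
by exists k.+1; rewrite iterSr.
Qed.

(* Least [k] such that the [k]-fold real iterate of [log2] at [x] is at most 1,
   in particular 0 for [x <= 1]. *)
Definition log2star (x : R) : nat := ex_minn (ex_iter_log2_le1 x).

End BallWalk.

(* [tower 0 = 1], so that [tower 1 = 2] and [tower k.+1 = 2 ^ tower k]. *)
Fixpoint tower (k : nat) : nat := if k is k'.+1 then (2 ^ tower k')%N else 1%N.

(* Main.v *)
Require Import Defs.
From mathcomp Require Import all_boot all_order all_algebra.
From mathcomp Require Import all_classical all_reals all_analysis.
From mathcomp Require Import ring lra zify.

Set Implicit Arguments.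
Unset Strict Implicit.
Unset Printing Implicit Defensive.

Import Order.TTheory GRing.Theory Num.Theory.
Local Open Scope ring_scope.

(** From a vertex [i] the walk can go down to a [j < i] with [2 ^ j <= i], or up
    to a [j > i] with [2 ^ i <= j].  As [Q j] is [2 ^ -(j + 1)], an upward step
    is doubly exponentially unlikely, while a downward step at least takes a
    logarithm, so [log2star] drops by one at each such step.  Hence about
    [log2star i] steps are needed to come back to small vertices from [i], and
    after that the walk forgets its starting point geometrically fast.

    Upper bound.  The function [potential i = 2 ^ log2star i] satisfies the
    drift condition [K V <= V / 2 + 49] ([potential_drift]).  All vertices
    [k <= n] share the neighbour [z = 2 ^ (n + 1) - 1], whose binary digits
    [0..n] are all 1, so from each of them the walk jumps to [z] with
    probability at least [alpha = Q z].  Drift and minorization combine into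
    Harris' theorem, proved here without any coupling.  For two probability
    distributions [p], [q], the difference [p - q] has mass zero, so any measure
    [a] may be subtracted from every row of [K] without changing [(p - q) K];
    therefore the weighted norm [sum_j w j * |(p - q) j|] contracts by a factor
    [rho] as soon as each row satisfies
    [sum_j w j * |K k j - a j| <= rho * w k] ([weighted_contraction]).  With
    [a] the mass [alpha] at [z] and [w = 1 + beta * V], [beta] being of order
    [alpha], this row condition holds for some [rho < 1] ([ballK_contracts]).
    Applied to [q = ballpi], which is stationary, and to the point mass at [i],
    it gives a bound [c * V i * rho ^ l], and [V i <= exp (log2star i)].

    Lower bound.  Starting from [tower k], whose only neighbour below it is
    [tower (k - 1)], the walk descends the towers one by one for the first [k]
    steps with probability at least 2/3 ([kpow_tower]), because the failure
    probabilities are summable.  After [l <= k] steps it thus charges the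
    single vertex [tower (k - l)] with mass at least 2/3, whereas the
    stationary mass of any single vertex is at most 1/2 ([ballpi_le_half]). *)

(** * Series of nonnegative reals *)

Section NonnegativeSeries.
Context {R : realType}.
Implicit Types (f g p q w a : nat -> R).

(** Sums take values in [\bar R], so that comparing and exchanging them requires
    no summability. *)
Definition nsum f : \bar R := (\sum_(0 <= j <oo) (f j)%:E)%E.

Lemma eq_nsum f g : f =1 g -> nsum f = nsum g.
Proof. by move=> fg; apply: eq_eseriesr => j _; rewrite fg. Qed.

Lemma nsum_ge0 f : (forall j, 0 <= f j) -> (0 <= nsum f)%E.
Proof. by move=> f0; apply: nneseries_ge0 => j _ _; rewrite lee_fin. Qed.

Lemma le_nsum f g :
  (forall j, 0 <= f j) -> (forall j, f j <= g j) -> (nsum f <= nsum g)%E.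
Proof.
by move=> f0 fg; apply: lee_nneseries => j *; rewrite lee_fin.
Qed.

Lemma nsumD f g : (forall j, 0 <= f j) -> (forall j, 0 <= g j) ->
  nsum (fun j => f j + g j) = (nsum f + nsum g)%E.
Proof.
move=> f0 g0; rewrite -nneseriesD; do ?by move=> j *; rewrite lee_fin.
by apply: eq_eseriesr.
Qed.

Lemma nsumZ c f : (forall j, 0 <= f j) ->
  nsum (fun j => c * f j)%R = (c%:E * nsum f)%E.
Proof.
move=> f0; rewrite -nneseriesZl; last by move=> j _; rewrite lee_fin.
by apply: eq_eseriesr.
Qed.

Lemma nsum_delta z f : 0 <= f z ->
  nsum (fun j => (z == j)%:R * f j) = (f z)%:E.
Proof.
move=> fz.
have pos j : true -> (0 <= ((z == j)%:R * f j)%:E)%E.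
  by move=> _; case: eqP => [<-|_]; rewrite lee_fin ?mul1r ?mul0r.
rewrite /nsum (nneseriesD1 (n := z)) // eqxx mul1r.
rewrite [X in (_ + X)%E](_ : _ = 0%E) ?adde0 //.
rewrite eseries_mkcond eseries0 // => j _ _ /=.
by case: ifP => // /negPf; rewrite eq_sym => ->; rewrite mul0r.
Qed.

Lemma term_le_nsum f z : (forall j, 0 <= f j) -> ((f z)%:E <= nsum f)%E.
Proof.
move=> f0; rewrite -(nsum_delta (f0 z)).
by apply: le_nsum => j; case: eqP => _; rewrite ?mul1r ?mul0r.
Qed.

Lemma nsum_telescope f g : (forall j, 0 <= f j) -> (forall j, 0 <= g j) ->
  (forall j, f j <= g j - g j.+1) -> (nsum f <= (g 0%N)%:E)%E.
Proof.
move=> f0 g0 fg; apply: lime_le.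
  by apply: is_cvg_nneseries => j _ _; rewrite lee_fin.
apply: nearW => n; rewrite sumEFin lee_fin.
suff : \sum_(0 <= i < n) f i <= g 0%N - g n by have := g0 n; lra.
elim: n => [|n IHn]; first by rewrite big_geq // subrr.
by rewrite big_nat_recr //=; have := fg n; lra.
Qed.

Lemma nsum_le_fin f c : (forall j, 0 <= f j) -> (nsum f <= c%:E)%E ->
  exists2 s, nsum f = s%:E & 0 <= s <= c.
Proof.
move=> f0 fc; have := nsum_ge0 f0.
by case: (nsum f) fc => [s|//|//]; rewrite !lee_fin => sc s0; exists s => //; rewrite s0.
Qed.

(** Tonelli's theorem for a double array whose row and column sums are finite;
    every interchange of two sums in a Markov computation has this form. *)
Lemma nsum_exchange (a : nat -> nat -> R) (u v : nat -> R) :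
  (forall i j, 0 <= a i j) ->
  (forall i, nsum (a i) = (u i)%:E) -> (forall j, nsum (a^~ j) = (v j)%:E) ->
  nsum u = nsum v.
Proof.
move=> a0 au av.
transitivity (\sum_(0 <= i <oo) \sum_(0 <= j <oo) (a i j)%:E)%E.
  by apply: eq_eseriesr => i _; rewrite -au.
rewrite nneseries_interchange; last by move=> i j; rewrite lee_fin.
by apply: eq_eseriesr => j _; rewrite -av.
Qed.

(** As [p] and [q] have the same mass, replacing [h] by [h - c] does not change
    [sum (p - q) h].  To avoid signed series, each half of the absolute value
    comes from the termwise inequality
    [p h + c q <= q h + c p + |p - q| |h - c|]. *)
Lemma abs_sub_nsum_le p q (h : nat -> R) (c x y : R) :
  (forall k, 0 <= p k) -> (forall k, 0 <= q k) -> (forall k, 0 <= h k) ->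
  0 <= c -> nsum p = 1%E -> nsum q = 1%E ->
  nsum (fun k => p k * h k) = x%:E -> nsum (fun k => q k * h k) = y%:E ->
  (`|x - y|%:E <= nsum (fun k => `|p k - q k| * `|h k - c|)%R)%E.
Proof.
move=> p0 q0 h0 c0 p1 q1 px qy.
set f := fun k => _; have f0 k : 0 <= f k by exact: mulr_ge0.
have one_side p' q' x' y' :
    (forall k, 0 <= p' k) -> (forall k, 0 <= q' k) ->
    nsum p' = 1%E -> nsum q' = 1%E ->
    nsum (fun k => p' k * h k) = x'%:E -> nsum (fun k => q' k * h k) = y'%:E ->
    (forall k, (p' k - q' k) * (h k - c) <= f k) ->
    (x'%:E <= y'%:E + nsum f)%E.
  move=> p'0 q'0 p'1 q'1 px' qy' pqf.
  have : (nsum (fun k => p' k * h k + c * q' k)%R <=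
          nsum (fun k => (q' k * h k + c * p' k) + f k)%R)%E.
    apply: le_nsum => k; first by rewrite addr_ge0 ?mulr_ge0.
    by have := pqf k; lra.
  have ph0 k : 0 <= p' k * h k by rewrite mulr_ge0.
  have qh0 k : 0 <= q' k * h k by rewrite mulr_ge0.
  have cp0 k : 0 <= c * p' k by rewrite mulr_ge0.
  have cq0 k : 0 <= c * q' k by rewrite mulr_ge0.
  have qc0 k : 0 <= q' k * h k + c * p' k by rewrite addr_ge0.
  rewrite !nsumD // !nsumZ // p'1 q'1 px' qy' mule1.
  by rewrite addeAC leeD2rE.
have H1 : (x%:E <= y%:E + nsum f)%E.
  apply: (one_side p q x y p0 q0 p1 q1 px qy) => k.
  by rewrite /f -normrM ler_norm.
have H2 : (y%:E <= x%:E + nsum f)%E.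
  apply: (one_side q p y x q0 p0 q1 p1 qy px) => k.
  by rewrite /f distrC -normrM ler_norm.
case: (nsum f) (nsum_ge0 f0) H1 H2 => [s _| _ _ _|//]; last by rewrite leey.
rewrite -!EFinD !lee_fin => H1 H2; rewrite ler_norml; lra.
Qed.

(** Harris-type contraction: [a] stands for the part common to the rows of [K],
    which cancels against the zero mass of [p - q].  Where [a]
    exceeds a row, the row condition pays for the excess through
    [`|K k j - a j|]. *)
Lemma weighted_contraction (p q p' q' w a : nat -> R) (K : nat -> nat -> R) rho :
  (forall k, 0 <= p k) -> (forall k, 0 <= q k) ->
  (forall k j, 0 <= K k j) -> (forall j, 0 <= w j) -> (forall j, 0 <= a j) ->
  nsum p = 1%E -> nsum q = 1%E ->
  (forall j, nsum (fun k => p k * K k j) = (p' j)%:E) ->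
  (forall j, nsum (fun k => q k * K k j) = (q' j)%:E) ->
  (forall k, nsum (fun j => w j * `|K k j - a j|)%R <= (rho * w k)%:E)%E ->
  (nsum (fun j => w j * `|p' j - q' j|)%R <=
    rho%:E * nsum (fun j => w j * `|p j - q j|)%R)%E.
Proof.
move=> p0 q0 K0 w0 a0 p1 q1 pK qK Kw.
pose b j k : R := w j * (`|p k - q k| * `|K k j - a j|).
have b0 j k : 0 <= b j k by rewrite /b !mulr_ge0.
rewrite -nsumZ; last by move=> j; exact: mulr_ge0.
apply: (@le_trans _ _ (\sum_(0 <= j <oo) nsum (b j))%E).
  apply: lee_nneseries => j *; first by rewrite lee_fin mulr_ge0.
  rewrite nsumZ; last by move=> k; exact: mulr_ge0.
  rewrite EFinM; apply: lee_wpmul2l; first by rewrite lee_fin.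
  exact: abs_sub_nsum_le (pK j) (qK j).
rewrite /nsum nneseries_interchange; last by move=> j k; rewrite lee_fin.
apply: lee_nneseries => k *.
  by apply: nneseries_ge0 => j *; rewrite lee_fin.
have -> : (rho * (w k * `|p k - q k|))%:E = (`|p k - q k|%:E * (rho * w k)%:E)%E.
  by rewrite -EFinM; congr EFin; ring.
apply: le_trans (lee_wpmul2l _ (Kw k)); last by rewrite lee_fin.
rewrite -nsumZ; last by move=> j; exact: mulr_ge0.
by apply: le_nsum => j //; rewrite /b mulrCA.
Qed.

End NonnegativeSeries.

(** * Powers of a stochastic matrix *)

Section StochasticPowers.
Context {R : realType} (K : nat -> nat -> R).
Context (K_ge0 : forall i j, 0 <= K i j) (K_sum : forall i, nsum (K i) = 1%E).

Let distribution_rows (M : nat -> nat -> R) :=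
  (forall i j, 0 <= M i j) /\ (forall i, nsum (M i) = 1%E).

(** The sum defining [kpow] through [fine] is finite, since the entries of [kpow]
    are at most 1. *)
Lemma kpowSE l : distribution_rows (kpow K l) ->
  forall i j, nsum (fun k => K i k * kpow K l k j) = (kpow K l.+1 i j)%:E.
Proof.
move=> [p0 p1] i j.
have pos k : 0 <= K i k * kpow K l k j by rewrite mulr_ge0.
have [|s Es _] := nsum_le_fin (c := 1) pos.
  rewrite -(K_sum i); apply: le_nsum => // k.
  by rewrite ler_piMr // -lee_fin -[leRHS](p1 k) term_le_nsum.
by rewrite Es /= -/(nsum _) Es.
Qed.

Lemma kpow_distribution l : distribution_rows (kpow K l).
Proof.
elim: l => [|l IHl].
  split=> [i j|i]; first exact: ler0n.
  rewrite -(nsum_delta (z := i) (f := fun=> 1 : R)) ?ler01 //.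
  by apply: eq_nsum => j; rewrite mulr1.
have [p0 p1] := IHl; have pE := kpowSE IHl.
split=> [i j|i].
  by rewrite -lee_fin -pE; apply: nsum_ge0 => k; rewrite mulr_ge0.
rewrite -(K_sum i); symmetry.
apply: (nsum_exchange (a := fun k j => K i k * kpow K l k j)) => // [k j|k].
  by rewrite mulr_ge0.
by rewrite nsumZ // p1 mule1.
Qed.

Lemma kpowS l i j :
  nsum (fun k => K i k * kpow K l k j) = (kpow K l.+1 i j)%:E.
Proof. exact: kpowSE (kpow_distribution l) i j. Qed.

Lemma kpow_ge0 l i j : 0 <= kpow K l i j.
Proof. by have [] := kpow_distribution l. Qed.

Lemma kpow_sum l i : nsum (kpow K l i) = 1%E.
Proof. by have [] := kpow_distribution l. Qed.

(** The recursion of [kpow] multiplies by [K] on the left; the evolution of the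
    law of the walk needs the multiplication on the right. *)
Lemma kpowSr l i j :
  nsum (fun k => kpow K l i k * K k j) = (kpow K l.+1 i j)%:E.
Proof.
elim: l i j => [|l IHl] i j.
  rewrite nsum_delta // -kpowS -(nsum_delta (z := j) (f := fun k => K i k)) //.
  by apply: eq_nsum => k /=; rewrite eq_sym mulrC.
rewrite -kpowS; symmetry.
apply: (nsum_exchange (a := fun m k => K i m * (kpow K l m k * K k j))) => [m k|m|k].
- by rewrite !mulr_ge0 ?kpow_ge0.
- by rewrite nsumZ ?IHl // => k; rewrite mulr_ge0 ?kpow_ge0.
rewrite mulrC EFinM -kpowS -nsumZ; last by move=> m; rewrite mulr_ge0 ?kpow_ge0.
by apply: eq_nsum => m; ring.
Qed.

End StochasticPowers.

(** * The iterated logarithm and the potential *)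

Section IteratedLog.
Context {R : realType}.

Lemma log2_le (x : R) (n : nat) : 0 < x -> (log2 x <= n%:R) = (x <= (2 ^ n)%:R).
Proof.
move=> x0; have ln2_gt0 : 0 < ln (2 : R) by rewrite ln_gt0 // ltr1n.
rewrite /log2 ler_pdivrMr // mulr_natl -lnXn // ler_ln ?posrE ?exprn_gt0 //.
by rewrite natrX.
Qed.

Lemma log2star_eq0 (x : R) : x <= 1 -> log2star x = 0%N.
Proof.
by move=> x1; rewrite /log2star; case: ex_minnP => k _ /(_ 0%N x1); case: k.
Qed.

Lemma log2star_step (x : R) : 1 < x -> log2star x = (log2star (log2 x)).+1.
Proof.
move=> x1; rewrite /log2star; case: ex_minnP => [[|k] /= Hk mink].
  by move: Hk; rewrite leNgt x1.
case: ex_minnP => m Hm minm; congr _.+1; apply/eqP; rewrite eqn_leq.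
rewrite -ltnS mink ?iterSr //= minm //.
by rewrite -iterSr.
Qed.

(** The towers are the thresholds of [log2star], which reduces every question
    about the iterated real logarithm to one about natural numbers. *)
Lemma log2star_le (x : R) k : (log2star x <= k)%N = (x <= (tower k)%:R).
Proof.
elim: k x => [|k IHk] x; have [x1|x1] := leP x 1.
- by rewrite log2star_eq0 // x1.
- by rewrite log2star_step //= leNgt x1.
- rewrite log2star_eq0 // leq0n; symmetry; apply: le_trans x1 _.
  by rewrite ler1n expn_gt0.
by rewrite log2star_step // ltnS IHk log2_le // (lt_trans ltr01).
Qed.

Lemma leq_expn_tower k : (2 ^ k <= tower k)%N.
Proof.
elim: k => // k IHk /=; rewrite leq_exp2l //.
by apply: leq_trans IHk; rewrite ltn_expl.
Qed.

(** The base only has to lie strictly between 1 and [expR 1]; with base 2 a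
    downward step halves the potential. *)
Definition potential (i : nat) : R := 2 ^+ log2star (i%:R : R).

Lemma potential_ge1 i : 1 <= potential i.
Proof. by rewrite exprn_ege1 // ler1n. Qed.

Lemma potential_le i : potential i <= 2 * i.+1%:R.
Proof.
rewrite /potential; case E: (log2star _) => [|k].
  by rewrite expr0 -natrM ler1n.
have : ~~ (log2star (i%:R : R) <= k)%N by rewrite E ltnn.
rewrite log2star_le ler_nat -ltnNge => ki.
rewrite exprS ler_pM2l // -natrX ler_nat.
exact: leqW (leq_trans (leq_expn_tower k) (ltnW ki)).
Qed.

(** The hypothesis holds for a downward step from [i] to [j].  The term 1 takes
    care of [i <= 1], where [log2star] cannot decrease. *)
Lemma potential_down i j :
  (2 ^ j <= i)%N -> potential j <= potential i / 2 + 1.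
Proof.
move=> ji; rewrite /potential; case E: (log2star (i%:R : R)) => [|k].
  have : (log2star (i%:R : R) <= 0)%N by rewrite E.
  rewrite log2star_le ler_nat /= => i1.
  have j0 : j = 0%N by case: j ji => // j; have := ltn_expl j.+1 (isT : 1 < 2)%N; lia.
  by rewrite j0 log2star_eq0 // ?ler01 //; lra.
have jk : (log2star (j%:R : R) <= k)%N.
  rewrite log2star_le ler_nat -(@leq_exp2l 2) //.
  apply: (leq_trans ji); rewrite -(ler_nat R) -/(tower k.+1) -log2star_le.
  by rewrite E.
rewrite exprS mulrC mulKf // -[leLHS]addr0 lerD //.
by rewrite ler_weXn2l // ler1n.
Qed.

(** The sublevel sets of the potential are finite, hence covered by the
    minorization of [rado_adj_all_ones]. *)
Lemma potential_coercive (c : R) :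
  exists n, forall k, (n < k)%N -> c <= potential k.
Proof.
pose m := Num.bound `|c|; exists (tower m) => k mk.
apply: (le_trans (ler_norm c)); apply/ltW.
apply: (lt_le_trans (archi_boundP (normr_ge0 c))).
rewrite -/m /potential -natrX ler_nat.
have : ~~ (log2star (k%:R : R) <= m)%N.
  by rewrite log2star_le ler_nat -ltnNge.
rewrite -ltnNge => mls; apply: leq_trans (ltnW mls) _.
by rewrite ltnW // ltn_expl.
Qed.

End IteratedLog.

(** * The Rado graph *)

Lemma rado_adjC i j : rado_adj i j = rado_adj j i.
Proof. by rewrite /rado_adj orbC. Qed.

Lemma rado_adj_irr i : rado_adj i i = false.
Proof. by rewrite /rado_adj ltnn. Qed.

Lemma odd_digit_leq i j : odd (i %/ 2 ^ j) -> (2 ^ j <= i)%N.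
Proof. by case: leqP => // /divn_small ->. Qed.

Lemma rado_adj_up i j : (i < j)%N -> rado_adj i j -> (2 ^ i <= j)%N.
Proof.
by move=> ij; rewrite /rado_adj ij ltnNge (ltnW ij) orbF; exact: odd_digit_leq.
Qed.

Lemma rado_adj_down i j : (j < i)%N -> rado_adj i j -> (2 ^ j <= i)%N.
Proof. by rewrite rado_adjC; exact: rado_adj_up. Qed.

Lemma rado_adj_leading_digit i : (0 < i)%N -> rado_adj i (trunc_log 2 i).
Proof.
move=> i0; have /andP[ti it] := @trunc_log_bounds 2 i isT i0.
rewrite rado_adjC /rado_adj (leq_trans (ltn_expl _ _) ti) //=.
suff -> : (i %/ 2 ^ trunc_log 2 i)%N = 1%N by [].
apply/eqP; rewrite eqn_leq leq_divRL ?expn_gt0 // mul1n ti andbT.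
by rewrite -ltnS ltn_divLR ?expn_gt0 // -expnS.
Qed.

(** All of [0..n] have the common neighbour that is written with [n + 1] digits
    1; this is what makes finite sets of vertices small in the sense of
    Doeblin. *)
Lemma rado_adj_all_ones n i : (i <= n)%N -> rado_adj i (2 ^ n.+1).-1%N.
Proof.
move=> i_n; set z := (2 ^ n.+1).-1.
have zE : z = ((2 ^ (n.+1 - i)).-1 * 2 ^ i + (2 ^ i).-1)%N.
  have : (2 ^ (n.+1 - i) * 2 ^ i = 2 ^ n.+1)%N by rewrite -expnD subnK // ltnW.
  have := expn_gt0 2 i; have := expn_gt0 2 (n.+1 - i); rewrite /z /=; nia.
rewrite /rado_adj; have -> : (i < z)%N.
  by rewrite /z expnS; have := ltn_expl n (isT : 1 < 2)%N; lia.
rewrite zE divnMDl ?expn_gt0 // divn_small ?prednK ?expn_gt0 // addn0.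
rewrite subSn // expnS; have := expn_gt0 2 (n - i); lia.
Qed.

Lemma rado_adj_exp t : rado_adj (2 ^ t)%N t.
Proof. by rewrite rado_adjC /rado_adj ltn_expl //= divnn expn_gt0. Qed.

Lemma rado_adj_exp_down t j : (j < 2 ^ t)%N -> rado_adj (2 ^ t)%N j -> j = t.
Proof.
move=> jt; rewrite /rado_adj jt ltnNge (ltnW jt) /=.
have [jt'|tj|//] := ltngtP j t; last by rewrite divn_small // ltn_exp2l.
rewrite -(subnK (ltnW jt')) expnD mulnK ?expn_gt0 //.
by rewrite oddX subn_eq0 leqNgt jt'.
Qed.

(** * The ball walk and its stationary distribution *)

Section RadoWalk.
Context {R : realType}.
Local Notation Q := (@Qgeom R).
Local Notation K := (ballK Q).
Local Notation pi := (ballpi Q).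
Local Notation QN i := (Qset Q (rado_nbr i)).
Local Notation adj i j := ((rado_adj i j)%:R : R).

Lemma Qgeom_gt0 j : 0 < Q j.
Proof. by rewrite exprn_gt0 // invr_gt0 ltr0n. Qed.

Lemma Qgeom_ge0 j : 0 <= Q j.
Proof. exact/ltW/Qgeom_gt0. Qed.

Local Hint Resolve Qgeom_gt0 Qgeom_ge0 : core.

Lemma QgeomE j : Q j = (2 ^+ j.+1)^-1.
Proof. by rewrite /Qgeom exprVn. Qed.

Lemma QgeomS j : Q j.+1 = Q j / 2.
Proof. by rewrite /Qgeom exprSr. Qed.

Lemma nsum_Qgeom_tail m :
  (nsum (fun j => (m <= j)%N%:R * Q j)%R <= (2^-1 ^+ m)%:E)%E.
Proof.
have := @nsum_telescope R (fun j => (m <= j)%N%:R * Q j) (fun j => 2^-1 ^+ maxn m j).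
rewrite maxn0; apply => [j|j|j].
- by rewrite mulr_ge0.
- by rewrite exprn_ge0 // invr_ge0.
rewrite /Qgeom; case: leqP => mj.
  rewrite (maxn_idPr (leqW mj)) mul1r exprS.
  by have := Qgeom_ge0 j; rewrite /Qgeom exprS; lra.
by rewrite (maxn_idPl mj) mul0r subrr.
Qed.

Lemma nsum_Qgeom_le1 : (nsum Q <= 1)%E.
Proof.
have := nsum_Qgeom_tail 0; rewrite expr0; apply: le_trans.
by apply: le_nsum => // j; rewrite mul1r.
Qed.

(** The second moment of a geometric variable, by telescoping the tails
    [(j ^ 2 + 4 j + 6) / 2 ^ j]. *)
Lemma nsum_sqr_Qgeom : (nsum (fun j => j.+1%:R ^+ 2 * Q j)%R <= 6%:E)%E.
Proof.
pose g (j : nat) : R := (j%:R ^+ 2 + 4 * j%:R + 6) * 2^-1 ^+ j.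
have := @nsum_telescope R (fun j => j.+1%:R ^+ 2 * Q j) g.
rewrite /g expr0 mulr1 expr0n /= mulr0 !add0r; apply => [j|j|j].
- by rewrite mulr_ge0 ?exprn_ge0.
- by rewrite mulr_ge0 ?exprn_ge0 ?invr_ge0 // !addr_ge0 ?mulr_ge0 ?exprn_ge0.
by rewrite /Qgeom [2^-1 ^+ j.+1]exprS -natr1 le_eqVlt; apply/orP; left; apply/eqP; field.
Qed.

Lemma nsum_nbr i : nsum (fun j => adj i j * Q j) = (QN i)%:E.
Proof.
have pos j : 0 <= adj i j * Q j by rewrite mulr_ge0.
have [|s Es _] := nsum_le_fin (c := 1) pos.
  apply: le_trans nsum_Qgeom_le1; apply: le_nsum => // j.
  by case: rado_adj; rewrite ?mul1r ?mul0r.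
rewrite Es; congr EFin; rewrite /Qset eseries_mkcond.
rewrite -[LHS](_ : fine s%:E = s) // -Es; congr fine.
apply: eq_eseriesr => j _; rewrite /rado_nbr rado_adjC.
by case: rado_adj; rewrite ?mul1r ?mul0r.
Qed.

Lemma QN_le1 i : QN i <= 1.
Proof.
rewrite -lee_fin -nsum_nbr; apply: le_trans nsum_Qgeom_le1.
apply: le_nsum => j; first by rewrite mulr_ge0.
by case: rado_adj; rewrite ?mul1r ?mul0r.
Qed.

Lemma Q_le_QN i j : rado_adj i j -> Q j <= QN i.
Proof.
move=> ij; rewrite -lee_fin -nsum_nbr.
have -> : Q j = adj i j * Q j by rewrite ij mul1r.
by apply: (term_le_nsum (f := fun j => adj i j * Q j)) => k; rewrite mulr_ge0.
Qed.

(** Every vertex [i] has a neighbour [j <= i + 1]: its leading binary digit, or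
    the vertex 1 when [i = 0]. *)
Lemma QN_ge i : (2 ^+ i.+2)^-1 <= QN i.
Proof.
have [j /Q_le_QN + ji] : exists2 j, rado_adj i j & (j <= i.+1)%N.
  case: i => [|i]; first by exists 1%N.
  exists (trunc_log 2 i.+1); first exact: rado_adj_leading_digit.
  have /andP[ti _] := @trunc_log_bounds 2 i.+1 isT isT.
  exact: ltnW (leqW (leq_trans (ltn_expl _ _) ti)).
apply: le_trans; rewrite QgeomE lef_pV2 ?posrE ?exprn_gt0 //.
by rewrite ler_weXn2l // ler1n.
Qed.

Lemma QN_gt0 i : 0 < QN i.
Proof. by apply: lt_le_trans (QN_ge i); rewrite invr_gt0 exprn_gt0. Qed.

Local Hint Resolve QN_gt0 : core.

Lemma QN_ge0 i : 0 <= QN i. Proof. exact: ltW. Qed.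
Local Hint Resolve QN_ge0 : core.

Lemma ballKE i j : K i j = (QN i)^-1 * (adj i j * Q j).
Proof.
by rewrite /ballK; case: rado_adj; rewrite ?mul0r ?mulr0 // mul1r mulrC.
Qed.

Lemma ballK_ge0 i j : 0 <= K i j.
Proof. by rewrite ballKE !mulr_ge0 ?invr_ge0. Qed.

Lemma ballK_sum i : nsum (K i) = 1%E.
Proof.
rewrite (eq_nsum (ballKE i)) nsumZ => [|j]; last by rewrite mulr_ge0.
by rewrite nsum_nbr -EFinM mulVf // gt_eqF.
Qed.

Local Hint Resolve ballK_ge0 ballK_sum : core.

Lemma nsum_ballZ : nsum (fun i => Q i * QN i) = (ballZ Q)%:E.
Proof.
have pos i : 0 <= Q i * QN i by rewrite mulr_ge0.
have [|s Es _] := nsum_le_fin (c := 1) pos.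
  apply: le_trans nsum_Qgeom_le1; apply: le_nsum => // i.
  by rewrite ler_piMr // QN_le1.
by rewrite /ballZ -/(nsum _) Es.
Qed.

Lemma ballZ_gt0 : 0 < ballZ Q.
Proof.
rewrite -lte_fin -nsum_ballZ.
apply: lt_le_trans (term_le_nsum (f := fun i => Q i * QN i) 0 _).
  by rewrite lte_fin mulr_gt0.
by move=> i; rewrite mulr_ge0.
Qed.

Local Hint Resolve ballZ_gt0 : core.

Lemma ballpi_ge0 i : 0 <= pi i.
Proof. by rewrite /ballpi divr_ge0 ?mulr_ge0 // ltW. Qed.

Local Hint Resolve ballpi_ge0 : core.

Lemma ballpi_sum : nsum pi = 1%E.
Proof.
rewrite -(@eq_nsum R (fun i => (ballZ Q)^-1 * (Q i * QN i))).
  rewrite nsumZ => [|i]; last by rewrite mulr_ge0.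
  by rewrite nsum_ballZ -EFinM mulVf // gt_eqF.
by move=> i; rewrite /ballpi mulrC.
Qed.

(** Reversibility: the product [pi k * K k j] is [Q k * Q j / Z] on the edges,
    hence symmetric. *)
Lemma ballpi_stationary j : nsum (fun k => pi k * K k j) = (pi j)%:E.
Proof.
have QZ0 : 0 <= Q j / ballZ Q by rewrite divr_ge0 // ltW.
have -> : pi j = Q j / ballZ Q * QN j by rewrite /ballpi; ring.
rewrite EFinM -nsum_nbr -nsumZ => [|k]; last by rewrite mulr_ge0.
apply: eq_nsum => k; rewrite ballKE /ballpi [rado_adj j k]rado_adjC.
by field; rewrite !gt_eqF.
Qed.

(** The graph has no loops, so the mass of [m] at stationarity comes in one step
    from the other vertices, and is at most their mass [1 - pi m]. *)
Lemma ballpi_le_half m : pi m <= 1 / 2.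
Proof.
have pK k : 0 <= pi k * K k m by rewrite mulr_ge0.
have pd k : 0 <= (m == k)%:R * pi k by rewrite mulr_ge0.
have : (nsum (fun k => pi k * K k m + (m == k)%:R * pi k)%R <= nsum pi)%E.
  apply: le_nsum => k; first by rewrite addr_ge0.
  have [->|_] := eqVneq.
    by rewrite ballKE rado_adj_irr mul0r !mulr0 mul1r add0r.
  rewrite mul0r addr0 ler_piMr // -lee_fin -(ballK_sum k).
  exact: term_le_nsum.
rewrite nsumD // ballpi_stationary nsum_delta // ballpi_sum -EFinD lee_fin; lra.
Qed.

(** * Drift and contraction *)

(** An upward neighbour [j] of [i] satisfies [2 ^ i <= j], so that the lower
    bound [2 ^ -(i + 2)] on [Q (N i)] costs only a factor [4 j]. *)
Lemma ballK_up i j : (i < j)%N -> K i j <= 4 * j.+1%:R * Q j.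
Proof.
move=> ij; rewrite ballKE; case E: (rado_adj i j); last first.
  by rewrite mul0r mulr0 !mulr_ge0.
rewrite mul1r ler_pM2r // -[leRHS]invrK lef_pV2 ?posrE ?invr_gt0 ?mulr_gt0 //.
apply: le_trans (QN_ge i); rewrite lef_pV2 ?posrE ?exprn_gt0 ?mulr_gt0 //.
rewrite !exprS mulrA -natrM ler_pM2l // -natrX ler_nat.
exact: leqW (rado_adj_up ij E).
Qed.

(** Downward steps at least halve the potential, up to 1; upward steps
    contribute at most [8 (j + 1) ^ 2 Q j] each, that is 48 in total. *)
Lemma potential_drift i :
  (nsum (fun j => K i j * potential j)%R <= (potential i / 2 + 49)%:E)%E.
Proof.
have V0 j : 0 <= potential j :> R by apply: le_trans (potential_ge1 j).
set V := potential in V0 *.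
have c0 : 0 <= V i / 2 + 1 by rewrite addr_ge0 ?divr_ge0.
have sq0 j : 0 <= j.+1%:R ^+ 2 * Q j by rewrite mulr_ge0 ?exprn_ge0.
apply: (@le_trans _ _
  (nsum (fun j => (V i / 2 + 1) * K i j + 8 * (j.+1%:R ^+ 2 * Q j))%R)).
  apply: le_nsum => j; first by rewrite mulr_ge0.
  have [ij|ji] := ltnP i j.
    apply: (@le_trans _ _ (4 * j.+1%:R * Q j * (2 * j.+1%:R))).
      by rewrite ler_pM // ?ballK_up ?potential_le.
    rewrite (_ : _ * _ = 8 * (j.+1%:R ^+ 2 * Q j)); last by ring.
    by rewrite lerDr mulr_ge0.
  apply: (@le_trans _ _ ((V i / 2 + 1) * K i j)); last first.
    by rewrite lerDl mulr_ge0.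
  rewrite mulrC ballKE; case E: (rado_adj i j); last by rewrite mul0r !mulr0.
  apply: ler_wpM2r; first by rewrite !mulr_ge0 ?invr_ge0.
  apply: potential_down; apply: (rado_adj_down _ E).
  by rewrite ltn_neqAle ji andbT; apply: contraTneq E => ->; rewrite rado_adj_irr.
rewrite nsumD => [||j]; do ?by move=> *; rewrite mulr_ge0.
  rewrite !nsumZ // ballK_sum mule1.
  apply: (@le_trans _ _ ((V i / 2 + 1)%:E + 8%:E * 6%:E)%E).
    by rewrite leeD2lE // lee_pmul2l // ?nsum_sqr_Qgeom.
  by rewrite -EFinM -EFinD lee_fin; lra.
Qed.

Lemma potential_ge0 i : 0 <= potential i :> R.
Proof. by apply: le_trans (potential_ge1 i). Qed.

Local Hint Resolve potential_ge0 : core.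

Lemma Q_le_ballK i j : rado_adj i j -> Q j <= K i j.
Proof.
move=> ij; rewrite ballKE ij mul1r; apply: ler_peMl => //.
by rewrite invf_ge1 // QN_le1.
Qed.

Lemma Qgeom_potential_le2 j : Q j * potential j <= 2.
Proof.
apply: (@le_trans _ _ (Q j * (2 * j.+1%:R))); first by rewrite ler_pM2l // potential_le.
rewrite mulrCA ger_pMr // QgeomE ler_pdivrMl ?exprn_gt0 // mulr1 -natrX ler_nat.
by rewrite ltnW // ltn_expl.
Qed.

Lemma Qgeom_le1 j : Q j <= 1.
Proof. by rewrite /Qgeom exprn_ile1 ?invr_ge0 // invf_le1 ?ler1n. Qed.

(** The mass [alpha = Q z] placed at [z] can be removed from the row of every
    [k <= n]: there the row sum decreases by [alpha], half of which absorbs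
    the drift constant, [49 beta = alpha / 2].  For [k > n] the removal may
    instead cost about [alpha], but there the decrease
    [beta * potential k / 4] is at least [11 alpha / 4].  Gains and
    losses are all proportional to [alpha], so it does not matter how small a
    large [n] makes it. *)
Lemma ballK_contracts : exists beta rho : R, exists z, [/\ 0 <= beta, 0 < rho < 1 &
  forall k, (nsum (fun j => (1 + beta * potential j) *
                            `|K k j - (z == j)%:R * Q z|)%R <=
             (rho * (1 + beta * potential k))%:E)%E].
Proof.
(* 1078 = 11 * 98 makes [beta * potential k >= 11 * alpha] for [k > n]. *)
have [n Vlarge] := @potential_coercive R 1078.
pose z := (2 ^ n.+1).-1%N.
have [alpha alphaE] : exists alpha, alpha = Q z by exists (Q z).
have Vz := Qgeom_potential_le2 z.
have adj_z k : (k <= n)%N -> rado_adj k z by exact: rado_adj_all_ones.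
have alpha0 : 0 < alpha by rewrite alphaE.
have alpha1 : alpha <= 1 by rewrite alphaE Qgeom_le1.
clearbody z; rewrite -alphaE in Vz.
have [beta betaE] : exists beta, beta = alpha / 98 by exists (alpha / 98).
have beta0 : 0 <= beta by rewrite betaE divr_ge0 // ltW.
pose rho := 1 - alpha / 4.
exists beta, rho, z; split => //; first by rewrite /rho; lra.
pose w j : R := 1 + beta * potential j.
have w0 j : 0 <= w j by rewrite addr_ge0 // mulr_ge0.
have wK0 k j : 0 <= w j * K k j by rewrite mulr_ge0.
have wd0 j : 0 <= (z == j)%:R * (w j * alpha) by rewrite !mulr_ge0 // ltW.
move=> k; rewrite -alphaE -/(w k).
have Kw : (nsum (fun j => w j * K k j)%R <= (1 + beta * (potential k / 2 + 49))%:E)%E.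
  rewrite (_ : nsum _ = nsum (fun j => K k j + beta * (K k j * potential j))); last first.
    by apply: eq_nsum => j; rewrite /w; ring.
  rewrite nsumD => [|//|j]; last by rewrite !mulr_ge0.
  rewrite nsumZ => [|j]; last by rewrite mulr_ge0.
  by rewrite ballK_sum EFinD leeD2lE // EFinM lee_wpmul2l ?lee_fin // potential_drift.
have [s wKs /andP[s0 s_le]] := nsum_le_fin (wK0 k) Kw.
have wz : nsum (fun j => (z == j)%:R * (w j * alpha)) = (w z * alpha)%:E.
  by rewrite (nsum_delta (f := fun j => w j * alpha)) // mulr_ge0 // ltW.
have abs0 j : 0 <= w j * `|K k j - (z == j)%:R * alpha| by rewrite mulr_ge0.
have betaV : beta * potential z * alpha <= alpha / 49.
  rewrite betaE; have := potential_ge0 z; nra.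
have [kn|nk] := leqP k n.
  rewrite -(leeD2rE (x := (w z * alpha)%:E)) // -{1}wz -nsumD //.
  rewrite (_ : nsum _ = nsum (fun j => w j * K k j)); last first.
    apply: eq_nsum => j; have [<-|_] := eqVneq z j; last first.
      by rewrite !mul0r subr0 addr0 ger0_norm.
    rewrite !mul1r ger0_norm ?subr_ge0; first by rewrite mulrBr subrK.
    by rewrite alphaE; exact/Q_le_ballK/adj_z.
  rewrite wKs -EFinD lee_fin (le_trans s_le) // /w /rho.
  have : 0 <= beta * potential k by rewrite mulr_ge0.
  have : 0 <= beta * potential z by rewrite mulr_ge0.
  rewrite (_ : beta * (potential k / 2 + 49) = beta * potential k / 2 + alpha / 2); last first.
    by rewrite betaE; field.
  move: (beta * potential k) (beta * potential z) => u v; nra.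
apply: (@le_trans _ _ (nsum (fun j => w j * K k j + (z == j)%:R * (w j * alpha)))).
  apply: le_nsum => j; first exact: abs0.
  apply: (@le_trans _ _ (w j * (K k j + (z == j)%:R * alpha))).
    apply: ler_wpM2l; first exact: w0.
    apply: le_trans (ler_normB _ _) _.
    by rewrite !ger0_norm // mulr_ge0 // ltW.
  by rewrite le_eqVlt; apply/orP; left; apply/eqP; ring.
rewrite nsumD // wz wKs -EFinD lee_fin.
have alphaE' : alpha = beta * 98 by rewrite betaE; field.
have large : 11 * alpha <= beta * potential k.
  by rewrite alphaE' mulrCA ler_wpM2l //; have := Vlarge k nk; lra.
have small : alpha * (beta * potential k) <= beta * potential k.
  by rewrite ler_piMl // mulr_ge0.
move: s_le betaV large small; rewrite /w /rho; lra.
Qed.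

(** The stationary distribution is dominated by a multiple of [Q], and the
    potential grows at most linearly. *)
Lemma ballpi_weight_finite (beta : R) : 0 <= beta ->
  exists2 W : R, 0 <= W &
    (nsum (fun j => (1 + beta * potential j) * pi j)%R <= W%:E)%E.
Proof.
move=> beta0; pose D := (1 + 2 * beta) / ballZ Q.
have D0 : 0 <= D by rewrite divr_ge0 ?addr_ge0 ?mulr_ge0 // ltW.
exists (D * 6); first by rewrite mulr_ge0.
apply: (@le_trans _ _ (nsum (fun j => D * (j.+1%:R ^+ 2 * Q j)))).
  apply: le_nsum => j; first by rewrite mulr_ge0 // addr_ge0 // mulr_ge0.
  have -> : D * (j.+1%:R ^+ 2 * Q j) =
            ((1 + 2 * beta) * j.+1%:R ^+ 2) * (Q j * 1 / ballZ Q).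
    by rewrite /D; field; rewrite gt_eqF.
  apply: ler_pM => //; first by rewrite addr_ge0 // mulr_ge0.
    have j1 : 1 <= j.+1%:R :> R by rewrite ler1n.
    have := @potential_le R j; nra.
  by rewrite /ballpi ler_pM2r ?invr_gt0 // ler_pM2l // QN_le1.
rewrite nsumZ => [|j]; last by rewrite mulr_ge0 ?exprn_ge0.
by rewrite (EFinM D 6) lee_wpmul2l ?lee_fin // nsum_sqr_Qgeom.
Qed.

(** * Upper bound *)

Lemma tv_dist_upper : exists A B : R, [/\ 0 < A, 0 < B &
  forall i l : nat,
    (tv_dist (kpow K l i) pi <=
      (A * expR (log2star (i%:R : R))%:R * expR (- (B * l%:R)))%:E)%E].
Proof.
have [beta [rho [z [beta0 /andP[rho0 rho1] contr]]]] := ballK_contracts.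
have [W W0 piW] := ballpi_weight_finite beta0.
pose w j : R := 1 + beta * potential j.
have w1 j : 1 <= w j by rewrite lerDl mulr_ge0.
have w0 j : 0 <= w j by apply: le_trans (w1 j).
have k0 := kpow_ge0 ballK_ge0 ballK_sum.
pose N i l := nsum (fun j => w j * `|kpow K l i j - pi j|).
have N0 i : (N i 0%N <= ((1 + beta + W) * potential i)%:E)%E.
  apply: (@le_trans _ _ (nsum (fun j => (i == j)%:R * w j + w j * pi j))).
    apply: le_nsum => j; first by rewrite mulr_ge0.
    rewrite [(i == j)%:R * _]mulrC -mulrDr; apply: ler_wpM2l => //=.
    by apply: le_trans (ler_normB _ _) _; rewrite !ger0_norm.
  rewrite nsumD => [|j|j]; do ?by rewrite mulr_ge0.
  rewrite nsum_delta //; apply: le_trans (leeD2l _ piW) _.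
  rewrite -EFinD lee_fin /w; have := @potential_ge1 R i; nra.
have NS i l : (N i l.+1 <= rho%:E * N i l)%E.
  apply: (weighted_contraction (K := K) (a := fun j => (z == j)%:R * Q z)) => //.
  - by move=> j; rewrite mulr_ge0.
  - exact: kpow_sum.
  - exact: ballpi_sum.
  - by move=> j; exact: kpowSr.
  - by move=> j; exact: ballpi_stationary.
have Nl i l : (N i l <= (rho ^+ l * ((1 + beta + W) * potential i))%:E)%E.
  elim: l => [|l IHl]; first by rewrite expr0 mul1r.
  apply: le_trans (NS i l) _; rewrite exprS -mulrA EFinM.
  by rewrite lee_pmul2l // lte_fin.
exists (1 + beta + W), (- ln rho); split.
- by rewrite ltr_wpDr // ltr_wpDr.
- by rewrite oppr_gt0 ln_lt0 // rho0.
move=> i l; have tvN : (tv_dist (kpow K l i) pi <= N i l)%E.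
  rewrite /tv_dist -/(nsum _) -nsumZ //; apply: le_nsum => j.
    by rewrite mulr_ge0 // invr_ge0.
  by apply: ler_wpM2r => //; apply: le_trans (w1 j); lra.
apply: (le_trans tvN); apply: (le_trans (Nl i l)); rewrite lee_fin.
rewrite mulNr opprK mulrC -mulrA [ln rho * _]mulrC expRM_natl lnK ?posrE //.
rewrite mulrA; apply: ler_pM => //.
- by rewrite mulr_ge0 ?addr_ge0.
- by rewrite exprn_ge0 // ltW.
apply: ler_wpM2l; first by rewrite !addr_ge0.
rewrite -[X in expR X]mulr1 expRM_natl /potential.
by apply: lerXn2r; rewrite ?nnegrE ?expR_ge0 // -[2]/(1 + 1) expR_ge1Dx.
Qed.

(** * Lower bound *)

Lemma leq_exp_linear t : (3 * t + 1 <= 2 ^ t.+1)%N.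
Proof. by elim: t => // -[|t] // IHt; rewrite expnS; lia. Qed.

Lemma tower_gap k : (2 * k.+1 + (tower k).+1 <= 2 ^ tower k.+1)%N.
Proof.
have kt : (k < tower k)%N by apply: leq_trans (leq_expn_tower k); exact: ltn_expl.
have : (2 ^ (tower k).+1 <= 2 ^ tower k.+1)%N by rewrite leq_exp2l // ltn_expl.
have := leq_exp_linear (tower k); lia.
Qed.

(** The only neighbour of [tower k.+1 = 2 ^ tower k] below it is [tower k]; all
    the others are at least [2 ^ tower k.+1], so their total weight is
    negligible against [Q (tower k)]. *)
Lemma ballK_tower k : 1 - 4^-1 ^+ k.+1 <= K (tower k.+1) (tower k).
Proof.
have gap := tower_gap k.
have adj_t : rado_adj (tower k.+1) (tower k) by exact: rado_adj_exp.
have QtN := Q_le_QN adj_t.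
rewrite ballKE adj_t mul1r mulrC ler_pdivlMr //.
have : QN (tower k.+1) <= Q (tower k) + 2^-1 ^+ (2 ^ tower k.+1).
  rewrite -lee_fin -nsum_nbr EFinD.
  rewrite -(nsum_delta (z := tower k) (f := Q)) //.
  apply: le_trans (leeD2l _ (nsum_Qgeom_tail _)).
  rewrite -nsumD => [|j|j]; do ?by rewrite mulr_ge0.
  apply: le_nsum => j; first by rewrite mulr_ge0.
  rewrite -mulrDl; apply: ler_wpM2r => //.
  case E: rado_adj; last by rewrite addr_ge0.
  have [jt|tj|jt] := ltngtP j (tower k.+1).
  - by rewrite (rado_adj_exp_down jt E) eqxx lerDl.
  - by rewrite (rado_adj_up tj E) lerDr.
  - by rewrite jt rado_adj_irr in E.
have : 2^-1 ^+ (2 ^ tower k.+1) <= 4^-1 ^+ k.+1 * Q (tower k).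
  have -> : 4^-1 = 2^-1 ^+ 2 :> R by field.
  rewrite -exprM -exprD; apply: ler_wiXn2l gap; first by rewrite invr_ge0.
  by rewrite invf_le1 ?ler1n.
have : 4^-1 ^+ k.+1 * Q (tower k) <= 4^-1 ^+ k.+1 * QN (tower k.+1).
  by apply: ler_wpM2l => //; rewrite exprn_ge0 // invr_ge0.
lra.
Qed.

(** The failure probabilities [4 ^ -r], for [m < r <= m + l], add up to
    [(4 ^ -m - 4 ^ -(m + l)) / 3], which is at most 1/3. *)
Lemma kpow_tower l m :
  1 - (4^-1 ^+ m - 4^-1 ^+ (m + l)) / 3 <= kpow K l (tower (m + l)) (tower m).
Proof.
have e0 r : 0 <= 4^-1 ^+ r :> R by rewrite exprn_ge0 // invr_ge0.
have e1 r : 4^-1 ^+ r <= 1 :> R.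
  by rewrite exprn_ile1 ?invr_ge0 // invf_le1 ?ler1n.
elim: l => [|l IHl]; first by rewrite addn0 subrr mul0r subr0 /= eqxx.
rewrite -lee_fin -kpowS // addnS.
apply: (@le_trans _ _ (K (tower (m + l).+1) (tower (m + l)) *
                       kpow K l (tower (m + l)) (tower m))%:E); last first.
  apply: (term_le_nsum (f := fun k => K _ k * kpow K l k _)) => j.
  by rewrite mulr_ge0 ?kpow_ge0.
rewrite lee_fin; apply: (@le_trans _ _ ((1 - 4^-1 ^+ (m + l).+1) *
    (1 - (4^-1 ^+ m - 4^-1 ^+ (m + l)) / 3))).
  have : 4^-1 ^+ (m + l) <= 4^-1 ^+ m :> R.
    by apply: ler_wiXn2l; rewrite ?invr_ge0 ?leq_addr // invf_le1 ?ler1n.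
  have := e0 (m + l)%N; rewrite exprS.
  move: (4^-1 ^+ m) (4^-1 ^+ (m + l)) => x y; nra.
apply: ler_pM => //; first by rewrite subr_ge0.
  by have := e1 m; have := e0 (m + l)%N; lra.
exact: ballK_tower.
Qed.

(** The constant is half of the gap between the mass 2/3 of the walk and the
    mass 1/2 of the stationary distribution at [tower (k - l)]. *)
Lemma tv_dist_lower k l : (l <= k)%N ->
  ((1 / 12)%:E <= tv_dist (kpow K l (tower k)) pi)%E.
Proof.
move=> lk; set x := tower (k - l).
rewrite /tv_dist -/(nsum _) -nsumZ //.
apply: le_trans (term_le_nsum (f := fun j => 2^-1 * `|kpow K l (tower k) j - pi j|) x _).
  have := kpow_tower l (k - l); rewrite subnK // -/x => p.
  have := ballpi_le_half x => q.
  have e1 : 4^-1 ^+ (k - l) <= 1 :> R.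
    by rewrite exprn_ile1 ?invr_ge0 // invf_le1 ?ler1n.
  have e0 : 0 <= 4^-1 ^+ k :> R by rewrite exprn_ge0 // invr_ge0.
  have := ler_norm (kpow K l (tower k) x - pi x); rewrite lee_fin; lra.
by move=> j; rewrite mulr_ge0 // invr_ge0.
Qed.

End RadoWalk.

Theorem theorem1p1 (R : realType) :
  let Q : nat -> R := Qgeom in
  let K := ballK Q in
  let pi := ballpi Q in
  (exists A B : R, [/\ 0 < A, 0 < B &
     forall i l : nat, (1 <= l)%N ->
       (tv_dist (kpow K l i) pi <=
         (A * expR (log2star (i%:R : R))%:R * expR (- (B * l%:R)))%:E)%E])
  /\
  (exists2 C : R, 0 < C &
     forall k : nat, (1 <= k)%N -> forall l : nat, (l <= k)%N ->
       (C%:E <= tv_dist (kpow K l (tower k)) pi)%E).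
Proof.
split.
  have [A [B [A0 B0 AB]]] := @tv_dist_upper R.
  by exists A, B; split => // i l _; exact: AB.
by exists (1 / 12) => [|k _ l]; [rewrite divr_gt0 | exact: tv_dist_lower].
Qed.
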